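(* Let $\alpha>0$. Then there exists a constant $C>0$, depending only on $\alpha$, such that for each $\delta\in(0,\frac14)$ and each monic polynomial $P$ (with complex coefficients) of degree $n\ge1$, $$c_{h_\alpha}\big(\{z\in\mathbb C:|P(z)|\le\delta^n\}\big)\le C\Big(\log\frac1{4\delta}\Big)^{-\frac12}n^{\frac12}(\log(n+e))^{-\alpha/3}.$$
   Context: A gauge function is a strictly increasing continuous $f:(0,\infty)\to[0,\infty)$ with $\lim_{t\to0^+}f(t)=0$. For a gauge function $f$ and $E\subset\mathbb C\cong\mathbb R^2$, the $f$-Hausdorff content is $c_f(E)=\inf\{\sum_{j\ge1} f(d(B_j)):E\subset\bigcup_{j\ge1} B_j\}$, where the $B_j$ are open balls (discs) with diameter $d(B_j)$. $h_\alpha(t)=(\log\frac1t)^{-1/2}(\log\log\frac1t)^{-\alpha}$ for $0<t\le e^{-3}$, understood as a gauge function on $(0,\infty)$ via a fixed extension with $h_\alpha(t)\sim1$ as $t\to+\infty$. *)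

(* Defs.v *)
From HB Require Import structures.
From mathcomp Require Import all_boot all_order all_algebra.
From mathcomp Require Import complex.
From mathcomp Require Import all_classical all_reals all_analysis.
Set Implicit Arguments.
Unset Strict Implicit.
Unset Printing Implicit Defensive.
Import Order.TTheory GRing.Theory Num.Theory.
Import numFieldNormedType.Exports.
Local Open Scope classical_set_scope.
Local Open Scope complex_scope.
Local Open Scope ring_scope.

(* A gauge function lives on (0, +oo); it is represented by a total function
   R -> R of which only the values at positive reals are constrained. *)
Definition gauge (R : realType) (f : R -> R) : Prop :=
  [/\ {in `]0, +oo[ &, {homo f : s t / s < t}},
      {in `]0, +oo[, continuous f},
      (forall t : R, 0 < t -> 0 <= f t)
    & f t @[t --> 0^'+] --> (0 : R)].

Definition disc (R : realType) (c : R[i]) (r : R) : set R[i] :=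
  [set z | `|z - c| < r%:C].

(* All radii are positive, so every disc of a covering is non-empty and has
   diameter 2 r > 0, the domain of a gauge function.  The sum of a covering may
   be +oo, so the content takes its values in the extended reals. *)
Definition hausdorff_content (R : realType) (f : R -> R) (E : set R[i]) :
    \bar R :=
  ereal_inf [set S | exists (c : nat -> R[i]) (r : nat -> R),
    [/\ forall j, 0 < r j,
        E `<=` \bigcup_j disc (c j) (r j)
      & S = (\sum_(0 <= j <oo) (f (2 * r j))%:E)%E]].

(* h is a gauge function extending the formula for h_alpha from (0, e^-3] to
   (0, +oo), with h(t) ~ 1 at +oo. *)
Definition is_h (R : realType) (alpha : R) (h : R -> R) : Prop :=
  [/\ gauge h,
      forall t : R, 0 < t -> t <= expR (- 3) ->
        h t = ln (1 / t) `^ (- (1 / 2)) * ln (ln (1 / t)) `^ (- alpha)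
    & h t @[t --> +oo] --> (1 : R)].

Definition lemniscate_set (R : realType) (P : {poly R[i]}) (s : R) : set R[i] :=
  [set z | `|P.[z]| <= s%:C].

(* Main.v *)
Require Import Defs.
From HB Require Import structures.
From mathcomp Require Import all_boot all_order all_algebra.
From mathcomp Require Import complex.
From mathcomp Require Import all_classical all_reals all_analysis.
From mathcomp Require Import ring lra.
Set Implicit Arguments.
Unset Strict Implicit.
Unset Printing Implicit Defensive.
Import Order.TTheory GRing.Theory Num.Theory.
Import numFieldNormedType.Exports.
Local Open Scope classical_set_scope.
Local Open Scope complex_scope.
Local Open Scope ring_scope.

(* Cartan's covering argument.  Fix radii r_1 <= r_2 <= ...; greedily removing,
   from the highest rank down, the zeros in a disc of radius r_k that contains
   at least k of them yields discs of radii 2 r_(k_j) with sum of the k_j at most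
   n.  Off these discs, every disc of radius r_k contains fewer than k zeros, so
   |P| >= r_1 ... r_n.  With A = n log (1/delta) and r_k = exp(-A/(4 k^(3/2)))
   this product exceeds exp(-A) = delta^n, because sum k^(-3/2) <= 3.  The
   exponent 3/2 < 2 leaves a factor k^(1/4) to spare, which pays for the
   logarithms: h(4 r_k) <= C k A^(-1/2) (log (n+e))^(-alpha/3), and summing over
   the discs gives n A^(-1/2) = n^(1/2) (log (1/delta))^(-1/2). *)

(** * Greedy covering and lower bounds for the product of the radii *)

Lemma cartan_cover (R : realType) (T : eqType) (d : T -> T -> R)
    (dC : forall x y, d x y = d y x)
    (d_tri : forall x y z, d x z <= d x y + d y z)
    (r : nat -> R) (r_mono : forall j k, (0 < j <= k)%N -> r j <= r k)
    (s : seq T) :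
  exists cs : seq (T * nat),
    [/\ {in cs, forall p, (0 < p.2)%N},
        (\sum_(p <- cs) p.2 <= size s)%N
      & forall z, {in cs, forall p, 2 * r p.2 <= d z p.1} ->
          forall k, (0 < k)%N -> (count (fun a => (d z a < r k)%R) s < k)%N].
Proof.
(* Generalised for a double induction: ranks above [m] are already under control, and the inner
   induction on the size bound [N] allows several discs of the same rank to be removed. At the start
   [m] is [size s], since no count exceeds it. *)
suff: forall m N s', (size s' <= N)%N ->
    (forall z k, (m < k)%N -> (count (fun a => (d z a < r k)%R) s' < k)%N) ->
    exists cs : seq (T * nat),
    [/\ {in cs, forall p, (0 < p.2)%N},
        (\sum_(p <- cs) p.2 <= size s')%N
      & forall z, {in cs, forall p, 2 * r p.2 <= d z p.1} ->
          forall k, (0 < k)%N -> (count (fun a => (d z a < r k)%R) s' < k)%N].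
  move=> /(_ (size s) (size s) s (leqnn _)); apply => z k.
  exact/leq_ltn_trans/count_size.
elim=> [|m IHm] N s' sN small.
  exists [::]; split => // [|z _ k]; first by rewrite big_nil.
  exact: small.
elim: N s' sN small => [|N IHN] s' sN small.
  exists [::]; split => // [|z _ k k0]; first by rewrite big_nil.
  apply: leq_ltn_trans (count_size _ _) _; exact: leq_ltn_trans sN k0.
(* Either some disc of radius [r m.+1] holds at least [m.+1] points, and removing them pays for the
   rank [m.+1], or rank [m.+1] is under control too and [m] decreases. *)
have [[z zbig]|nobig] :=
    pselect (exists z, (m < count (fun a => (d z a < r m.+1)%R) s')%N); last first.
  apply: (IHm N.+1 s' sN) => z k.
  rewrite leq_eqVlt => /predU1P[<-|]; last exact: small.
  by rewrite ltnS leqNgt; apply/negP => zk; apply: nobig; exists z.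
set B := fun a => d z a < r m.+1 in zbig.
pose s2 := seq.filter (predC B) s'.
have size_s2 : (count B s' + size s2 = size s')%N by rewrite size_filter count_predC.
have [cs [cs0 cs_sum cs_cov]] : exists cs : seq (T * nat),
    [/\ {in cs, forall p, (0 < p.2)%N},
        (\sum_(p <- cs) p.2 <= size s2)%N
      & forall z, {in cs, forall p, 2 * r p.2 <= d z p.1} ->
          forall k, (0 < k)%N -> (count (fun a => (d z a < r k)%R) s2 < k)%N].
  apply: IHN => [|w k mk].
    rewrite -ltnS (leq_trans _ sN)// -size_s2 -[X in (X < _)%N]add0n.
    by rewrite ltn_add2r (leq_ltn_trans _ zbig).
  apply: leq_ltn_trans (small w k mk).
  by rewrite count_filter; apply: sub_count => a /andP[].
exists ((z, m.+1) :: cs); split => [p||w far k k0].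
- by rewrite inE => /predU1P[->//|]; exact: cs0.
- by rewrite big_cons -size_s2 leq_add.
have [mk|km] := ltnP m.+1 k; first exact: small.
(* Since [w] is at distance at least [2 * r m.+1] from [z], a disc about [w] of radius
   [r k <= r m.+1] misses every removed point, so the counts in [s'] and [s2] agree. *)
have wz : 2 * r m.+1 <= d w z by apply: (far (z, m.+1)); rewrite mem_head.
suff -> : count (fun a => d w a < r k) s' = count (fun a => d w a < r k) s2.
  by apply: cs_cov => // p pcs; apply: far; rewrite inE pcs orbT.
rewrite count_filter; apply: eq_count => a /=; rewrite /B.
have [wa/=|//] := ltP (d w a) (r k).
apply/esym; rewrite -leNgt.
have rkm : r k <= r m.+1 by rewrite r_mono ?k0.
have := d_tri w a z; move: rkm; rewrite (dC a z); lra.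
Qed.

(** The counting hypothesis says that the [k]-th smallest entry is at least [r k]. Without sorting:
    at [k] equal to the size, some entry is at least the last radius; it is matched with that radius
    and removed. *)
Lemma prod_radii_le (R : realType) (r : nat -> R) (r0 : forall k, 0 <= r k)
    (t : seq R) :
  (forall k, (0 < k)%N -> (count (fun x => (x < r k)%R) t < k)%N) ->
  \prod_(1 <= k < (size t).+1) r k <= \prod_(x <- t) x.
Proof.
move e : (size t) => n; elim: n t e => [|n IHn] t sz_t ct.
  by rewrite (size0nil sz_t) big_nil big_geq.
have /hasP[x xt rx] : has (predC (fun x => (x < r n.+1)%R)) t.
  by rewrite has_predC all_count sz_t neq_ltn ct.
rewrite big_nat_recr//= (perm_big _ (perm_to_rem xt)) big_cons/= mulrC.
apply: ler_pM => //; first by rewrite prodr_ge0.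
  by rewrite /= -leNgt in rx.
apply: IHn => [|k k0]; first by rewrite size_rem// sz_t.
by rewrite (leq_ltn_trans _ (ct k k0))// (permP (perm_to_rem xt))/= leq_addl.
Qed.

(** Telescoping: with [a], [b] the square roots of consecutive integers,
    [2 / a - 2 / b = 2 / (a * b * (a + b))], which is at least [1 / b ^ 3]. The induction therefore
    carries the sharper bound [3 - 2 / sqrt n]. *)
Lemma sum_inv_powR32_le (R : realType) (n : nat) :
  \sum_(1 <= k < n.+1) (k%:R * Num.sqrt (k%:R : R))^-1 <= 3.
Proof.
case: n => [|n]; first by rewrite big_geq.
suff : \sum_(1 <= k < n.+2) (k%:R * Num.sqrt (k%:R : R))^-1
    <= 3 - 2 * (Num.sqrt n.+1%:R)^-1.
  have : 0 <= (Num.sqrt n.+1%:R : R)^-1 by rewrite invr_ge0 sqrtr_ge0.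
  lra.
elim: n => [|n IHn]; first by rewrite big_nat1 sqrtr1 mulr1 invr1; lra.
rewrite big_nat_recr//=.
set a := Num.sqrt (n.+1%:R : R) in IHn *.
set b := Num.sqrt (n.+2%:R : R).
have a0 : 0 < a by rewrite sqrtr_gt0 ltr0n.
have b0 : 0 < b by rewrite sqrtr_gt0 ltr0n.
have ab : a <= b by rewrite ler_sqrt// ler_nat.
have b2 : b ^+ 2 = n.+2%:R by rewrite sqr_sqrtr.
have b2a2 : b ^+ 2 = a ^+ 2 + 1 by rewrite b2 sqr_sqrtr// -natr1.
rewrite -b2.
suff : (b ^+ 2 * b)^-1 <= 2 * a^-1 - 2 * b^-1 by move: IHn; lra.
have -> : 2 * a^-1 - 2 * b^-1 = 2 / (a * b * (a + b)).
  have ab0 : a + b != 0 by rewrite gt_eqF// addr_gt0.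
  have -> : 2 * a^-1 - 2 * b^-1 = 2 * (b ^+ 2 - a ^+ 2) / (a * b * (a + b)).
    by field; rewrite ab0 !gt_eqF.
  by rewrite b2a2 (addrC (a ^+ 2)) addrK mulr1.
have ? : 0 < a * b * (a + b) by rewrite !mulr_gt0// addr_gt0.
rewrite -[leLHS]mul1r ler_pdivrMr ?mulr_gt0// mulrAC ler_pdivlMr// mul1r.
have : a * b * (a + b) <= b * b * (b + b).
  by rewrite !ler_pM ?lerD// ?mulr_ge0 ?addr_ge0 ?ltW//.
lra.
Qed.

(** * Hausdorff content bounded by finite covers *)

Lemma gauge_small (R : realType) (f : R -> R) (e : R) :
  gauge f -> 0 < e -> exists2 t : R, 0 < t & f (2 * t) <= e.
Proof.
move=> [_ _ _ f0] e0.
have /cvgrPdist_le/(_ e e0) := f0.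
rewrite near_withinE => /nbhs_ballP[t /= t0 tP].
exists (t / 4); first by rewrite divr_gt0.
have t2 : 0 < 2 * (t / 4) by rewrite mulr_gt0// divr_gt0.
have : `|0 - f (2 * (t / 4))| <= e.
  apply: tP => //; rewrite /ball/= sub0r normrN gtr0_norm//; lra.
by rewrite sub0r normrN; exact/le_trans/ler_norm.
Qed.

(** The content is defined by infinite sequences of discs of positive radius, so a finite cover is
    padded with discs so small that their gauges add up to at most [e]. *)
Lemma hausdorff_content_finite_cover (R : realType) (f : R -> R)
    (E : set R[i]) (cs : seq (R[i] * R)) :
  gauge f -> {in cs, forall p, 0 < p.2} ->
  E `<=` [set z | exists2 p, p \in cs & disc p.1 p.2 z] ->
  (hausdorff_content f E <= (\sum_(p <- cs) f (2 * p.2))%:E)%E.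
Proof.
move=> gf cs0 Ecs; apply/lee_addgt0Pr => e e0.
have f_ge0 : forall t, 0 < t -> 0 <= f t by case: gf.
have /choice[eta etaP] : forall j : nat, exists t : R,
    0 < t /\ f (2 * t) <= e / (2 ^ j.+1)%:R.
  move=> j; have [|t t0 tP] := @gauge_small R f (e / (2 ^ j.+1)%:R) gf.
    by rewrite divr_gt0// ltr0n expn_gt0.
  by exists t.
(* Past the end of [cs] the default only supplies the centre 0; the radius there is [eta j]. *)
pose p0 : R[i] * R := (0, 1).
pose c j := (nth p0 cs j).1.
pose r j := if (j < size cs)%N then (nth p0 cs j).2 else eta j.
have r0 j : 0 < r j.
  rewrite /r; case: ltnP => jcs; last by case: (etaP j).
  exact/cs0/mem_nth.
pose A j := if (j < size cs)%N then f (2 * (nth p0 cs j).2) else 0.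
have A0 j : 0 <= A j.
  rewrite /A; case: ltnP => // jcs.
  by apply: f_ge0; rewrite mulr_gt0// cs0// mem_nth.
apply: (@le_trans _ _ (\sum_(0 <= j <oo) (f (2 * r j))%:E)%E).
  apply: ereal_inf_lbound; exists c, r; split => // z /Ecs[p pcs zp].
  exists (index p cs) => //; rewrite /c /r index_mem pcs nth_index//.
apply: (@le_trans _ _
    (\sum_(0 <= j <oo) ((A j)%:E + (e / (2 ^ j.+1)%:R)%:E))%E).
  apply: lee_nneseries => j _ ; first by rewrite lee_fin f_ge0// mulr_gt0.
  rewrite -EFinD lee_fin /A /r; case: ltnP => jcs.
    by rewrite lerDl divr_ge0// ltW.
  by rewrite add0r; case: (etaP j).
apply: le_trans (epsilon_trick _ _ (ltW e0)) _ => [j|].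
  by rewrite lee_fin.
rewrite leeD2r// (nneseries_split _ (size cs)) => [|j _]; last by rewrite lee_fin.
rewrite add0n [X in (_ + X)%E]eseries0 ?adde0 => [|j csj _]; last first.
  by rewrite /A ltnNge csj.
rewrite sumEFin lee_fin (big_nth p0) le_eqVlt; apply/orP; left; apply/eqP.
by apply: eq_big_nat => j /andP[_ jcs]; rewrite /A jcs.
Qed.

(** * Estimates for the gauge at the diameters of the discs *)

Lemma le_powR (R : realType) (a b p : R) :
  0 <= p -> 0 < a -> a <= b -> a `^ p <= b `^ p.
Proof.
move=> p0 a0 ab; apply: ge0_ler_powR => //; rewrite nnegrE ltW//.
exact: lt_le_trans ab.
Qed.

Lemma le_powRN (R : realType) (a b p : R) :
  0 <= p -> 0 < a -> a <= b -> b `^ (- p) <= a `^ (- p).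
Proof.
move=> p0 a0 ab; have b0 : 0 < b := lt_le_trans a0 ab.
rewrite !powRN lef_pV2 ?posrE ?powR_gt0//.
exact: le_powR.
Qed.

(** An increasing function stays below its limit at infinity. This handles arguments too large for
    the explicit formula. *)
Lemma is_h_le1 (R : realType) (alpha : R) (h : R -> R) (t : R) :
  is_h alpha h -> 0 < t -> h t <= 1.
Proof.
move=> [[h_incr _ _ _] _ h1] t0; rewrite leNgt; apply/negP => ht.
have near_lt : \forall s \near +oo, h s < h t by apply: (cvgr_lt _ h1).
have near_ge : \forall s \near +oo, t < s by apply: nbhs_pinfty_gt; rewrite num_real.
have [s [hs ts]] := filter_ex (filterI near_lt near_ge).
have : h t < h s by apply: h_incr; rewrite // in_itv/= andbT// (lt_trans t0).
by rewrite ltNge (ltW hs).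
Qed.

(** Taking logarithms, [ln N] exceeds [ln y] by at most a constant plus [2 * ln k], and [ln k] is
    absorbed by a small power of [k]. The choice of [eps] turns that power into [1 / 4] after
    raising to [alpha / 3]; the exponent of [ln y] may then grow to [alpha] because [1 <= ln y]. *)
Lemma ln_powR_le (R : realType) (alpha K0 : R) : 0 < alpha -> 1 <= K0 ->
  exists2 K : R, 0 < K & forall (N y : R) (k : nat),
    (0 < k)%N -> 1 <= ln y -> expR 1 <= N ->
    N <= K0 * (k%:R * Num.sqrt k%:R) * y ->
    ln N `^ (alpha / 3) <= K * k%:R `^ (1 / 4) * ln y `^ alpha.
Proof.
move=> a0 K01; pose eps : R := 3 / (4 * alpha).
have eps0 : 0 < eps by rewrite divr_gt0 ?mulr_gt0.
have K1_gt0 : 0 < ln K0 + 2 / eps + 1.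
  have := ln_ge0 K01; have : 0 < 2 / eps by rewrite divr_gt0.
  lra.
exists ((ln K0 + 2 / eps + 1) `^ (alpha / 3)); first exact: powR_gt0.
move=> N y k k0 lny Ne Nle.
have k1 : 1 <= k%:R :> R by rewrite ler1n.
have k_gt0 : 0 < k%:R :> R by rewrite ltr0n.
have y0 : 0 < y.
  by rewrite ltNge; apply/negP => /(@ln0 R) lny0; move: lny; rewrite lny0 ler10.
have N0 : 0 < N := lt_le_trans (expR_gt0 _) Ne.
have K0_gt0 : 0 < K0 by lra.
have sk1 : 1 <= Num.sqrt (k%:R : R) by rewrite -[leLHS]sqrtr1 ler_sqrt.
have lnN : ln N <= ln K0 + 2 * ln k%:R + ln y.
  have kk0 : 0 < K0 * (k%:R * k%:R) by rewrite !mulr_gt0.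
  have -> : 2 * ln (k%:R : R) = ln (k%:R * k%:R) by rewrite lnM ?posrE//; lra.
  rewrite -lnM ?posrE ?mulr_gt0// -lnM ?posrE//.
  rewrite ler_ln ?posrE ?mulr_gt0// (le_trans Nle)//.
  rewrite ler_pM2r// ler_pM2l// ler_pM2l//.
  by rewrite -[leRHS]sqr_sqrtr ?ler_eXnr// ltW.
have keps1 : 1 <= (k%:R : R) `^ eps by rewrite -[leLHS](powRr0 k%:R) ler_powR// ltW.
have lnk : ln k%:R <= k%:R `^ eps / eps.
  by rewrite ler_pdivlMr// mulrC -ln_powR ltW// ln_sublinear// powR_gt0.
have lnN1 : 1 <= ln N by rewrite -[leLHS]expRK ler_ln ?posrE ?expR_gt0.
have {lnk}lnN_le : ln N <= (ln K0 + 2 / eps + 1) * k%:R `^ eps * ln y.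
  have e1 : 1 <= k%:R `^ eps * ln y by rewrite -[leLHS]mulr1 ler_pM.
  have e2 : ln K0 <= ln K0 * (k%:R `^ eps * ln y) by rewrite ler_peMr ?ln_ge0.
  have e3 : ln y <= k%:R `^ eps * ln y by rewrite ler_peMl ?(le_trans _ lny).
  have e4 : 2 * ln k%:R <= 2 / eps * (k%:R `^ eps * ln y).
    rewrite -mulrA ler_pM2l// (le_trans lnk)// mulrC ler_pM2l ?invr_gt0//.
    by rewrite ler_peMr ?powR_ge0.
  by move: lnN; rewrite -mulrA; lra.
have lny0 : 0 <= ln y by lra.
apply: (@le_trans _ _ (((ln K0 + 2 / eps + 1) * k%:R `^ eps * ln y) `^ (alpha / 3))).
  by apply: le_powR => //; lra.
rewrite !powRM ?mulr_ge0 ?powR_ge0 ?(ltW K1_gt0)// -powRrM.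
have -> : eps * (alpha / 3) = 1 / 4 by rewrite /eps; field; rewrite gt_eqF.
by rewrite ler_wpM2l ?mulr_ge0 ?powR_ge0// ler_powR//; lra.
Qed.

Lemma is_h_expR_le (R : realType) (alpha : R) : 0 < alpha ->
  exists2 C : R, 0 < C & forall h : R -> R, is_h alpha h ->
    forall s y : R, y = Num.max (s / 2) (3 + expR 1) ->
    h (4 * expR (- s)) <= C * y `^ (- (1 / 2)) * ln y `^ (- alpha).
Proof.
move=> a0; set M := 3 + expR 1.
have M3 : 3 <= M by rewrite lerDl expR_ge0.
have M0 : 0 < M by lra.
have lnM1 : 1 <= ln M by rewrite -[leLHS]expRK ler_ln ?posrE ?expR_gt0// lerDr.
have lnM0 : 0 < ln M by lra.
have C1 : 1 <= M `^ (1 / 2) * ln M `^ alpha.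
  rewrite -[leLHS]mulr1 ler_pM//.
    by rewrite -[leLHS](powRr0 M) ler_powR//; lra.
  by rewrite -[leLHS](powRr0 (ln M)) ler_powR//; lra.
(* With this constant the bound equals 1 at [y = M], so the case [s / 2 <= M] is [is_h_le1].
   Otherwise [s / 2] exceeds 3, which absorbs the factor 4 and brings the argument below
   [expR (- 3)]. *)
exists (M `^ (1 / 2) * ln M `^ alpha); first by rewrite mulr_gt0 ?powR_gt0.
move=> h hh s y ->.
have t0 : 0 < 4 * expR (- s) by rewrite mulr_gt0 ?expR_gt0.
case: (leP (s / 2) M) => sM.
  rewrite -mulrA mulrACA -!powRD ?(gt_eqF M0) ?(gt_eqF lnM0) ?implybT//.
  rewrite !addrN !powRr0 mulr1; exact: is_h_le1 hh t0.
have t_le : 4 * expR (- s) <= expR (- (s / 2)).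
  apply: (@le_trans _ _ (expR 3 * expR (- s))).
    by rewrite ler_pM2r ?expR_gt0// (le_trans _ (expR_ge1Dx _))//; lra.
  by rewrite -expRD ler_expR; lra.
have x_ge : s / 2 <= ln (1 / (4 * expR (- s))).
  have : ln (4 * expR (- s)) <= - (s / 2).
    by rewrite -[leRHS]expRK ler_ln ?posrE ?expR_gt0.
  by rewrite mul1r lnV ?posrE//; lra.
have s2_gt0 : 0 < s / 2 by lra.
have lns2 : 0 < ln (s / 2) by rewrite (lt_le_trans lnM0)// ler_ln ?posrE// ltW.
case: hh => _ -> //; last by rewrite (le_trans t_le)// ler_expR; lra.
rewrite -[leRHS]mulrA -[leLHS]mul1r ler_pM ?mulr_ge0 ?powR_ge0//.
rewrite ler_pM ?powR_ge0//; first by rewrite le_powRN//; lra.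
by rewrite le_powRN ?(ltW a0)// ler_ln ?posrE ?(lt_le_trans s2_gt0).
Qed.

Lemma is_h_radius_le (R : realType) (alpha : R) : 0 < alpha ->
  exists2 C : R, 0 < C & forall h : R -> R, is_h alpha h ->
    forall (n k : nat) (A : R), (0 < n)%N -> (0 < k)%N -> 3 / 4 * n%:R <= A ->
    h (4 * expR (- (A / (4 * (k%:R * Num.sqrt k%:R))))) <=
      C * k%:R * A `^ (- (1 / 2)) * ln (n%:R + expR 1) `^ (- (alpha / 3)).
Proof.
move=> a0; have [C0 C0_gt0 hC0] := is_h_expR_le a0.
have e0 := expR_gt0 (1 : R).
(* From [n <= 4 / 3 * A] and [A <= 8 * w * y] comes [n <= 32 / 3 * w * y], and 11 rounds up
   [32 / 3]. The 3 in the next constant bounds the square root of 8. *)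
have [|K K_gt0 hK] := @ln_powR_le R alpha (11 * (1 + expR 1)) a0; first by lra.
exists (3 * K * C0) => [|h hh n k A n0 k0 nA]; first by rewrite !mulr_gt0.
set w := k%:R * Num.sqrt k%:R; set s := A / (4 * w).
set y := Num.max (s / 2) (3 + expR 1).
have k_gt0 : 0 < k%:R :> R by rewrite ltr0n.
have n1 : 1 <= n%:R :> R by rewrite ler1n.
have w0 : 0 < w by rewrite mulr_gt0 ?sqrtr_gt0.
have yM : 3 + expR 1 <= y by rewrite le_max lexx orbT.
have ys : s / 2 <= y by rewrite le_max lexx.
have y0 : 0 < y by lra.
have lny : 1 <= ln y by rewrite -[leLHS]expRK ler_ln ?posrE//; lra.
have A0 : 0 < A by lra.
have A_le : A <= 8 * w * y.
  have -> : A = 8 * w * (s / 2) by rewrite /s; field; rewrite gt_eqF.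
  by rewrite ler_pM2l// mulr_gt0.
have N1 : 1 <= ln (n%:R + expR 1 : R).
  by rewrite -[leLHS]expRK ler_ln ?posrE//; lra.
have {}hK := hK (n%:R + expR 1) y k k0 lny.
have {}hK : ln (n%:R + expR 1) `^ (alpha / 3) <= K * k%:R `^ (1 / 4) * ln y `^ alpha.
  apply: hK; first by lra.
  have e1 : n%:R + expR 1 <= (1 + expR 1) * n%:R :> R.
    by rewrite mulrDl mul1r lerD2l ler_peMr// ltW.
  have e2 : (1 + expR 1) * n%:R <= (1 + expR 1) * (11 * (w * y)).
    rewrite ler_pM2l; last by lra.
    by move: A_le; rewrite -mulrA; have := mulr_gt0 w0 y0; lra.
  by apply: (le_trans e1); apply: (le_trans e2); rewrite -/w; lra.
have yinv : y `^ (- (1 / 2)) <= 3 * k%:R `^ (3 / 4) * A `^ (- (1 / 2)).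
  rewrite !powRN ler_pdivlMr ?powR_gt0// ler_pdivrMl ?powR_gt0//.
  apply: (@le_trans _ _ ((8 * w * y) `^ (1 / 2))).
    by apply: le_powR.
  rewrite powRM ?mulr_ge0 ?(ltW w0) ?(ltW y0)// mulrC ler_pM2l ?powR_gt0//.
  rewrite powRM ?(ltW w0)// ler_pM ?powR_ge0//.
    by rewrite div1r powR12_sqrt// -[leRHS]ger0_norm// -sqrtr_sqr ler_sqrt//; lra.
  have -> : w = k%:R `^ (3 / 2).
    have -> : (3 / 2 : R) = 1 + 2^-1 by lra.
    rewrite powRD ?powRr1 ?powR12_sqrt ?(ltW k_gt0)//.
    by rewrite (gt_eqF k_gt0) implybT.
  by rewrite -powRrM; have -> : 3 / 2 * (1 / 2) = 3 / 4 :> R by lra.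
have lninv : ln y `^ (- alpha) <=
    K * k%:R `^ (1 / 4) * ln (n%:R + expR 1) `^ (- (alpha / 3)).
  have [lnN0 lny0] : 0 < ln (n%:R + expR 1 : R) /\ 0 < ln y by lra.
  by rewrite !powRN ler_pdivlMr ?powR_gt0// ler_pdivrMl ?powR_gt0// [leRHS]mulrC.
apply: le_trans (hC0 h hh s y erefl) _.
apply: (@le_trans _ _ (C0 * (3 * k%:R `^ (3 / 4) * A `^ (- (1 / 2)))
    * (K * k%:R `^ (1 / 4) * ln (n%:R + expR 1) `^ (- (alpha / 3))))).
  rewrite ler_pM ?mulr_ge0 ?powR_ge0// ?(ltW C0_gt0)//.
  by rewrite ler_pM2l.
have k34 : k%:R = k%:R `^ (3 / 4) * k%:R `^ (1 / 4) :> R.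
  rewrite -powRD; last by rewrite (gt_eqF k_gt0) implybT.
  have -> : 3 / 4 + 1 / 4 = 1 :> R by lra.
  by rewrite powRr1// ltW.
by rewrite {3}k34 le_eqVlt; apply/orP; left; apply/eqP; ring.
Qed.

(** * Lemniscates and the final estimate *)

(** The norm on [R[i]] takes values in [R[i]]; [Normc.normc] is the modulus with values in [R],
    where the distances to the zeros are compared with the radii. *)
Lemma lemniscate_prod (R : realType) (P : {poly R[i]}) (n : nat) :
  P \is monic -> size P = n.+1 ->
  exists2 s : seq R[i], size s = n &
    forall z, `|P.[z]| = (\prod_(a <- s) Normc.normc (z - a))%:C.
Proof.
move=> /monicP Pm szP; have [s Ps] := closed_field_poly_normal P.
rewrite Pm scale1r in Ps; exists s => [|z].
  by apply: succn_inj; rewrite -szP Ps size_prod_XsubC.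
rewrite Ps horner_prod normr_prod rmorph_prod.
by apply: eq_bigr => a _; rewrite hornerXsubC.
Qed.

Theorem lemma3p8 (R : realType) (alpha : R) (alpha_gt0 : 0 < alpha) :
  exists C : R, 0 < C /\
    forall h : R -> R, is_h alpha h ->
    forall delta : R, 0 < delta -> delta < 1 / 4 ->
    forall (n : nat) (P : {poly R[i]}),
      (1 <= n)%N -> P \is monic -> size P = n.+1 ->
      (hausdorff_content h (lemniscate_set P (delta ^+ n)) <=
       (C * ln (1 / (4 * delta)) `^ (- (1 / 2)) * n%:R `^ (1 / 2)
          * ln (n%:R + expR 1) `^ (- (alpha / 3)))%:E)%E.
Proof.
have [C C_gt0 hC] := is_h_radius_le alpha_gt0.
exists C; split => // h hh delta d0 d4 n P n0 Pm szP.
have [s sz_s Ps] := lemniscate_prod Pm szP.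
have n_gt0 : 0 < n%:R :> R by rewrite ltr0n.
pose A := n%:R * ln (1 / delta).
have lnd : 3 / 4 <= ln (1 / delta).
  rewrite div1r lnV ?posrE// lerNr.
  have : ln delta <= delta - 1.
    by rewrite -[X in ln X](subrKC 1) le_ln1Dx//; lra.
  lra.
have nA : 3 / 4 * n%:R <= A by rewrite mulrC ler_pM2l.
have A_gt0 : 0 < A by rewrite (lt_le_trans _ nA)// mulr_gt0.
(* Division by zero gives 0, so [r 0 = 1]; monotonicity holds from index 1 on. *)
pose r k := expR (- (A / (4 * (k%:R * Num.sqrt (k%:R : R))))).
have r_mono j k : (0 < j <= k)%N -> r j <= r k.
  case/andP=> j0 jk; rewrite ler_expR lerN2 ler_pM2l// lef_pV2 ?posrE.
  - by rewrite ler_pM2l// ler_pM ?ler_nat ?sqrtr_ge0// ler_sqrt ?ler_nat.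
  - by rewrite !mulr_gt0 ?sqrtr_gt0 ?ltr0n// (leq_trans j0).
  - by rewrite !mulr_gt0 ?sqrtr_gt0 ?ltr0n.
have dC (x y : R[i]) : Normc.normc (x - y) = Normc.normc (y - x).
  by rewrite -normcN opprB.
have d_tri (x y z : R[i]) :
    Normc.normc (x - z) <= Normc.normc (x - y) + Normc.normc (y - z).
  by rewrite -[x - z](subrKA y) le_normcD.
have [cs [cs0 cs_sum cs_cov]] := cartan_cover dC d_tri r_mono s.
pose B := A `^ (- (1 / 2)) * ln (n%:R + expR 1) `^ (- (alpha / 3)).
have B0 : 0 <= B by rewrite mulr_ge0 ?powR_ge0.
apply: (@le_trans _ _
    (\sum_(p <- [seq (p.1, 2 * r p.2) | p <- cs]) h (2 * p.2))%:E).
  apply: hausdorff_content_finite_cover => [||z Ez].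
  - by case: hh.
  - by move=> _ /mapP[p _ ->]; rewrite /= mulr_gt0 ?expR_gt0.
  (* A point of the lemniscate outside all the discs would satisfy [delta ^+ n < |P(z)|], a
     contradiction. *)
  have [[p pcs zp]|far] := pselect
    (exists2 p, p \in cs & Normc.normc (z - p.1) < 2 * r p.2).
    exists (p.1, 2 * r p.2); first by apply/mapP; exists p.
    by rewrite /disc/= -ltcR in zp *.
  have /prod_radii_le : forall k, (0 < k)%N ->
      (count (fun x => (x < r k)%R) [seq (Normc.normc (z - a))%R | a <- s] < k)%N.
    move=> k k0; rewrite count_map; apply: cs_cov => // p pcs.
    by rewrite leNgt; apply/negP => zp; apply: far; exists p.
  move=> /(_ (fun k => expR_ge0 _)); rewrite size_map big_map sz_s.
  move: Ez; rewrite /lemniscate_set/= Ps lecR => /[swap] /le_trans /[apply].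
  suff : delta ^+ n < \prod_(1 <= k < n.+1) r k by rewrite ltNge => /negP.
  rewrite /r -expR_sum sumrN -[delta]lnK ?posrE// -expRM_natl ltr_expR.
  have -> : n%:R * ln delta = - A by rewrite /A div1r lnV ?posrE// mulrN opprK.
  rewrite ltrN2.
  (* The exponents add up to at most [3 * (A / 4)], which is strictly less than [A]. *)
  under eq_bigr do rewrite invfM mulrA.
  rewrite -mulr_sumr; have := sum_inv_powR32_le R n.
  rewrite -(ler_pM2l (_ : 0 < A / 4)) ?divr_gt0//; lra.
rewrite lee_fin big_map.
apply: (@le_trans _ _ (\sum_(p <- cs) (C * B) * p.2%:R)).
  rewrite !big_seq; apply: ler_sum => p pcs /=.
  rewrite mulrA -natrM -[(2 * 2)%N]/4%N.
  by have := hC h hh n p.2 A n0 (cs0 p pcs) nA; rewrite /B -/(r p.2); lra.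
rewrite -mulr_sumr -natr_sum.
apply: (@le_trans _ _ (C * B * n%:R)).
  by apply: ler_wpM2l; rewrite ?(mulr_ge0 (ltW C_gt0))// ler_nat -sz_s.
(* The bound obtained has [ln (1 / delta)]; replacing it by the smaller [ln (1 / (4 * delta))],
   positive since [delta < 1 / 4], only weakens it. *)
have L0 : 0 < ln (1 / (4 * delta)).
  by rewrite ln_gt0// ltr_pdivlMr ?mul1r ?mulr_gt0//; lra.
have LA : ln (1 / delta) `^ (- (1 / 2)) <= ln (1 / (4 * delta)) `^ (- (1 / 2)).
  apply: le_powRN => //; rewrite ler_ln ?posrE ?divr_gt0 ?mulr_gt0//.
  by rewrite !div1r lef_pV2 ?posrE ?mulr_gt0//; lra.
have -> : C * B * n%:R = C * ln (1 / delta) `^ (- (1 / 2)) * n%:R `^ (1 / 2)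
    * ln (n%:R + expR 1) `^ (- (alpha / 3)).
  rewrite /B /A powRM ?(ltW n_gt0)//; last by lra.
  have <- : n%:R * n%:R `^ (- (1 / 2)) = n%:R `^ (1 / 2) :> R.
    rewrite -{1}[n%:R]powRr1 ?ltW// -powRD; last by rewrite (gt_eqF n_gt0) implybT.
    by congr (_ `^ _); lra.
  by ring.
by rewrite ler_wpM2r ?powR_ge0// ler_wpM2r ?powR_ge0// ler_pM2l.
Qed.
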